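(* Let $\Omega$ be a Gromov hyperbolic train, with associated sequences $\{l_n\}_{n\ge1},\{r_n\}_{n\ge1}$, and suppose there is a constant $c_1>0$ with $l_m\le l_n+c_1$ for all positive integers $m\le n$. Let $$K:=\sup_{n\ge 1}\ \sup_{h\in[0,l_n]}\ \min_{m\in[A_n(h),B_n(h)]}\Gamma_{nm}(h).$$ Then $$\sum_{k=n}^{\infty}e^{-l_k}\le K\,e^{K+c_1}\,e^{-l_n}\qquad\text{for every } n \text{ with } l_n>2K+c_1.$$
   Context: Trains. A train is a domain $\Omega\subset\mathbb C$ whose boundary in the Riemann sphere is contained in $\mathbb R\cup\{\infty\}$ and such that $\Omega\cap\mathbb R=\bigcup_{n=0}^\infty (a_n,b_n)$ with $-\infty\le a_0$ and $a_n<b_n\le a_{n+1}$ for every $n\ge0$. It is endowed with its Poincaré metric (the complete metric of constant curvature $-1$ obtained by projecting $2|dz|/(1-|z|^2)$ from the unit disk, its universal cover) and the induced distance. For $n\ge1$, the fundamental geodesic $\gamma_n$ is the unique simple closed geodesic which intersects $\mathbb R$ just in $(a_0,b_0)$ and $(a_n,b_n)$, and $2l_n$ is its length. For $n\ge1$, the second fundamental geodesic $\sigma_n$ is the unique simple closed geodesic which intersects $\mathbb R$ just in $(a_n,b_n)$ and $(a_{n+1},b_{n+1})$, and $2r_n$ is its length. Punctures are regarded as simple closed geodesics of length zero: if $b_n=a_{n+1}$ then $r_n=0$, and if $b_0=a_1$ then $l_1=0$. Hyperbolicity. For a metric space $(X,d)$ the Gromov product is $(x|y)_w=\frac12(d(x,w)+d(y,w)-d(x,y))$.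 $X$ is $\delta$-hyperbolic ($\delta\ge0$) if $(x|z)_w\ge\min\{(x|y)_w,(y|z)_w\}-\delta$ for all $x,y,z,w\in X$, and (Gromov) hyperbolic if it is $\delta$-hyperbolic for some $\delta\ge 0$. (For a hyperbolic train the quantity $K$ is finite.) The functions. Write $x_+=\max\{x,0\}$; empty sums are $0$. For $n\ge1$ and $0\le h\le l_n$: $A_n(h):=\max\{m\ge 1: m<n,\ l_m\le h\}$ if this set is non-empty, and $A_n(h):=1$ otherwise; $B_n(h):=\min\{m>n:\ l_m\le h\}$ if this set is non-empty, and $B_n(h):=\infty$ otherwise. The index $m$ ranges over (finite) positive integers. Put, for $k\ge1$, $$\Delta(k):=e^{-l_k}+e^{-l_{k+1}}+e^{-\frac12(l_k+l_{k+1}-r_k)_+}+(r_k-l_k-l_{k+1})_+,$$ and, for $n,m\ge1$ and $0\le h\le l_n$, $$\Gamma_{nm}(h):=\begin{cases}(r_m+h-l_{m+1})_+ + e^h\sum_{k=m+1}^{n-1}\Delta(k), & m<n,\ l_m\le h,\\ l_m-h+e^h\sum_{k=m}^{n-1}\Delta(k), & m<n,\ l_m>h,\\ \min\{h,\,l_n-h\}, & m=n,\\ l_m-h+e^h\sum_{k=n}^{m-1}\Delta(k), & m>n,\ l_m>h,\\ (r_{m-1}+h-l_{m-1})_+ + e^h\sum_{k=n}^{m-2}\Delta(k), & m>n,\ l_m\le h.\end{cases}$$ *)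

(* Defs.v *)
From HB Require Import structures.
From mathcomp Require Import all_boot all_order all_algebra.
From mathcomp Require Import complex.
From mathcomp Require Import all_classical all_reals all_analysis.

Set Implicit Arguments.
Unset Strict Implicit.
Unset Printing Implicit Defensive.

Import Order.TTheory GRing.Theory Num.Theory.
Import numFieldNormedType.Exports.

Local Open Scope classical_set_scope.
Local Open Scope ring_scope.

(* The MathComp-Analysis topology and complex differentiation are available on
   the regular module R[i]^o, not on the bare type R[i]. *)
Notation Cplx R := ((R[i])^o).

(* The real-valued modulus (the generic norm of R[i] takes values in R[i]). *)
Definition cmod (R : realType) (z : Cplx R) : R :=
  complex.ComplexField.Normc.normc z.

(* Since Omega is a subset of C, its boundary in the Riemann sphere lies in
   R u {oo} iff its boundary in C lies in R. The endpoints are extended reals,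
   but the inequalities leave only a 0 possibly infinite. *)
Record train (R : realType) (Omega : set (Cplx R)) (a b : nat -> \bar R) : Prop :=
  Train {
    train_open : open Omega;
    train_connected : connected Omega;
    train_boundary :
      closure Omega `\` interior Omega `<=` [set z | complex.Im z = 0];
    train_intervals : forall n, (a n < b n)%E /\ (b n <= a n.+1)%E;
    train_real_trace : forall x : R,
      Omega (real_complex R x) <-> exists n, (a n < x%:E)%E /\ (x%:E < b n)%E
  }.

Definition unit_disk (R : realType) : set (Cplx R) := [set z | cmod z < 1].

Definition homeomorphism_on (R : realType) (V U : set (Cplx R))
    (p : Cplx R -> Cplx R) : Prop :=
  [/\ set_bij V U p,
      {within V, continuous p} &
      exists2 q : Cplx R -> Cplx R,
        {within U, continuous q} & forall z, V z -> q (p z) = z].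

Definition covering_map (R : realType) (D Omega : set (Cplx R))
    (p : Cplx R -> Cplx R) : Prop :=
  [/\ {within D, continuous p},
      p @` D = Omega &
      forall z, Omega z -> exists U : set (Cplx R),
        [/\ open U, U z, U `<=` Omega &
            exists F : set (set (Cplx R)),
              [/\ (forall V, F V -> open V),
                  trivIset F id,
                  \bigcup_(V in F) V = D `&` p @^-1` U &
                  forall V, F V -> homeomorphism_on V U p]]].

(* As the disk is simply connected, these coverings are universal. *)
Definition holomorphic_universal_cover (R : realType) (Omega : set (Cplx R))
    (p : Cplx R -> Cplx R) : Prop :=
  (forall z, unit_disk z -> derivable p z 1) /\
  covering_map (@unit_disk R) Omega p.

(* lam(z)|dz| is the Poincare metric of Omega: its pull-back by a universal
   covering map is 2|dz|/(1-|z|^2). This determines lam on Omega (and does not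
   depend on the covering); the values of lam outside Omega are irrelevant. *)
Definition poincare_density (R : realType) (Omega : set (Cplx R))
    (lam : Cplx R -> R) : Prop :=
  exists2 p : Cplx R -> Cplx R, holomorphic_universal_cover Omega p &
    forall z, unit_disk z ->
      lam (p z) * cmod ('D_1 p z) = 2 / (1 - cmod z ^+ 2).

Definition curve_re (R : realType) (g : R -> Cplx R) : R -> R :=
  fun t => complex.Re (g t).
Definition curve_im (R : realType) (g : R -> Cplx R) : R -> R :=
  fun t => complex.Im (g t).

Definition C1_at (R : realType) (f : R -> R) (t : R) : Prop :=
  derivable f t 1 /\ {for t, continuous (fun u => 'D_1 f u)}.

(* One-sided derivatives at the finitely many exceptional times are not
   required: this does not change the infimum of lengths below. *)
Definition piecewise_C1 (R : realType) (g : R -> Cplx R) : Prop :=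
  {within `[0, 1], continuous g} /\
  exists s : seq R, forall t, 0 < t < 1 -> t \notin s ->
    C1_at (curve_re g) t /\ C1_at (curve_im g) t.

Definition speed (R : realType) (g : R -> Cplx R) (t : R) : R :=
  Num.sqrt (('D_1 (curve_re g) t) ^+ 2 + ('D_1 (curve_im g) t) ^+ 2).

Definition curve_length (R : realType) (lam : Cplx R -> R)
    (g : R -> Cplx R) : \bar R :=
  (\int[@lebesgue_measure R]_(t in `[0%R, 1%R]) (lam (g t) * speed g t)%:E)%E.

Definition curves_between (R : realType) (Omega : set (Cplx R))
    (z w : Cplx R) : set (R -> Cplx R) :=
  [set g | [/\ piecewise_C1 g, g 0 = z, g 1 = w &
               forall t, 0 <= t <= 1 -> Omega (g t)]].

Definition induced_dist (R : realType) (Omega : set (Cplx R))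
    (lam : Cplx R -> R) (z w : Cplx R) : R :=
  fine (ereal_inf (curve_length lam @` curves_between Omega z w)).

Definition gromov_product (R : realType) (T : Type) (d : T -> T -> R)
    (x y w : T) : R :=
  (d x w + d y w - d x y) / 2.

Definition gromov_hyperbolic (R : realType) (T : Type) (X : set T)
    (d : T -> T -> R) : Prop :=
  exists2 delta : R, 0 <= delta &
    forall x y z w, X x -> X y -> X z -> X w ->
      gromov_product d x z w >=
        Num.min (gromov_product d x y w) (gromov_product d y z w) - delta.

(* Arc-length parametrization, periodic of minimal period L; hence L is the
   length of the geodesic. *)
Record simple_closed_geodesic (R : realType) (T : Type) (X : set T)
    (d : T -> T -> R) (g : R -> T) (L : R) : Prop :=
  SimpleClosedGeodesic {
    scg_length_gt0 : 0 < L;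
    scg_in : forall t, X (g t);
    scg_closed : forall t, g (t + L) = g t;
    scg_simple : forall s t, 0 <= s < L -> 0 <= t < L -> g s = g t -> s = t;
    scg_local_isometry : forall t, exists2 e : R, 0 < e &
      forall s u, `|s - t| < e -> `|u - t| < e -> d (g s) (g u) = `|s - u|
  }.

Definition on_interval (R : realType) (a b : nat -> \bar R) (i : nat)
    (z : Cplx R) : Prop :=
  [/\ complex.Im z = 0, (a i < (complex.Re z)%:E)%E &
      ((complex.Re z)%:E < b i)%E].

Definition meets_real_line_just_in (R : realType) (a b : nat -> \bar R)
    (i j : nat) (g : R -> Cplx R) : Prop :=
  [/\ forall t, complex.Im (g t) = 0 ->
        on_interval a b i (g t) \/ on_interval a b j (g t),
      exists t, on_interval a b i (g t) &
      exists t, on_interval a b j (g t)].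

(* L is the length of the simple closed geodesic meeting the real line just in
   the i-th and j-th intervals (i < j); L = 0 if these intervals are separated
   by a puncture only. *)
Definition geodesic_length_through (R : realType) (Omega : set (Cplx R))
    (d : Cplx R -> Cplx R -> R) (a b : nat -> \bar R) (i j : nat) (L : R) : Prop :=
  if b i == a j then L = 0
  else exists2 g : R -> Cplx R,
    simple_closed_geodesic Omega d g L & meets_real_line_just_in a b i j g.

(* The entries of index 0 of l and r are never used. *)
Definition train_lengths (R : realType) (Omega : set (Cplx R))
    (d : Cplx R -> Cplx R -> R) (a b : nat -> \bar R) (l r : nat -> R) : Prop :=
  forall n, (1 <= n)%N ->
    geodesic_length_through Omega d a b 0 n (2 * l n) /\
    geodesic_length_through Omega d a b n n.+1 (2 * r n).

Definition pos_part (R : realType) (x : R) : R := Num.max x 0.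

Definition A_index (R : realType) (l : nat -> R) (n : nat) (h : R) : nat :=
  maxn 1 (\max_(1 <= m < n | (l m <= h)%R) m).

(* The infimum of a set of integers, so a minimum, and +oo for the empty set. *)
Definition B_index (R : realType) (l : nat -> R) (n : nat) (h : R) : \bar R :=
  ereal_inf [set (m%:R)%:E | m in [set m : nat | (n < m)%N /\ l m <= h]].

Definition Delta (R : realType) (l r : nat -> R) (k : nat) : R :=
  expR (- l k) + expR (- l k.+1)
  + expR (- (2^-1 * pos_part (l k + l k.+1 - r k)))
  + pos_part (r k - l k - l k.+1).

Definition Gamma (R : realType) (l r : nat -> R) (n m : nat) (h : R) : R :=
  if (m < n)%N then
    if l m <= h then
      pos_part (r m + h - l m.+1) + expR h * \sum_(m.+1 <= k < n) Delta l r k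
    else l m - h + expR h * \sum_(m <= k < n) Delta l r k
  else if m == n then Num.min h (l n - h)
  else if l m <= h then
    pos_part (r m.-1 + h - l m.-1)
    + expR h * \sum_(n <= k < m.-1) Delta l r k
  else l m - h + expR h * \sum_(n <= k < m) Delta l r k.

(* A minimum even if B_index is +oo: either the series of Delta k >= expR (- l k)
   diverges or l k tends to +oo, so Gamma l r n m h tends to +oo with m. *)
Definition min_Gamma (R : realType) (l r : nat -> R) (n : nat) (h : R) : \bar R :=
  ereal_inf [set (Gamma l r n m h)%:E | m in
    [set m : nat | (A_index l n h <= m)%N /\ ((m%:R)%:E <= B_index l n h)%E]].

Definition K_sup (R : realType) (l r : nat -> R) : \bar R :=
  ereal_sup [set ereal_sup [set min_Gamma l r n h | h in [set h : R | 0 <= h <= l n]]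
            | n in [set n : nat | (1 <= n)%N]].

(* Main.v *)
(** Fix n and K' slightly above K, and put h = l_n - c1 - K'. For m >= n the
    hypothesis gives l_m - h >= K', while h > K'. Hence, for every N >= n, the
    nearly minimal value of Gamma_{Nm}(h), which is below K', is attained at
    some m < n, and such a value contains e^h times the sum of
    Delta(k) >= e^{-l_k} over n <= k < N. Let K' decrease to K. *)

Require Import Defs.
From mathcomp Require Import all_boot all_order all_algebra.
From mathcomp Require Import complex.
From mathcomp Require Import all_classical all_reals all_analysis.
From mathcomp Require Import lra.

Import Order.TTheory GRing.Theory Num.Theory.
Import numFieldNormedType.Exports.

Local Open Scope classical_set_scope.
Local Open Scope ring_scope.

Section Combinatorics.
Context {R : realType}.
Implicit Types (l r : nat -> R) (h K c : R) (n m N : nat).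

Lemma pos_part_ge0 (x : R) : 0 <= pos_part x.
Proof. by rewrite /pos_part le_max lexx orbT. Qed.

Lemma expRN_le_Delta l r k : expR (- l k) <= Delta l r k.
Proof.
rewrite /Delta -!addrA lerDl !addr_ge0 ?expR_ge0 //.
exact: pos_part_ge0.
Qed.

Lemma Delta_ge0 l r k : 0 <= Delta l r k.
Proof. exact: le_trans (expR_ge0 _) (expRN_le_Delta l r k). Qed.

Lemma expR_sum_Delta_ge0 l r h i j :
  0 <= expR h * \sum_(i <= k < j) Delta l r k.
Proof. by rewrite mulr_ge0 ?expR_ge0 ?sumr_ge0 // => k _; exact: Delta_ge0. Qed.

(** The term [l m - h] occurs only in branches where [h < l m]; the bounds on [h] serve the case
    [m = n]. *)
Lemma Gamma_ge0 l r n m h : 0 <= h <= l n -> 0 <= Gamma l r n m h.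
Proof.
move=> /andP[h0 hl]; rewrite /Gamma.
have S := expR_sum_Delta_ge0 l r h.
case: ltnP => _; last case: eqVneq => _; first 1 last.
- by rewrite le_min h0 subr_ge0.
- by case: (leP (l m) h) => [_|/ltW lh]; rewrite addr_ge0 ?subr_ge0 ?pos_part_ge0.
- by case: (leP (l m) h) => [_|/ltW lh]; rewrite addr_ge0 ?subr_ge0 ?pos_part_ge0.
Qed.

(** As [m < N], the sum in [Gamma] runs up to [N] from [m] or [m.+1]. Both are at most [n], so its
    range covers [n <= k < N]. *)
Lemma Gamma_ge_sum l r n m N h : (m < n)%N -> (n <= N)%N ->
  expR h * \sum_(n <= k < N) expR (- l k) <= Gamma l r N m h.
Proof.
move=> mn nN; rewrite /Gamma (leq_trans mn nN).
have D i : (i <= n)%N -> expR h * \sum_(n <= k < N) expR (- l k) <=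
    expR h * \sum_(i <= k < N) Delta l r k.
  move=> ile; rewrite ler_pM2l ?expR_gt0 // (big_cat_nat ile nN) /=.
  apply: ler_wpDl; first by apply: sumr_ge0 => k _; exact: Delta_ge0.
  by apply: ler_sum => k _; exact: expRN_le_Delta.
case: (leP (l m) h) => [_|/ltW lh]; apply: ler_wpDl; rewrite ?pos_part_ge0 ?subr_ge0 //.
  exact: D.
exact/D/ltnW.
Qed.

Lemma Gamma_ge_right l r N m h K : 0 < K -> K <= h -> h + K <= l N ->
  (N <= m)%N -> h + K <= l m -> K <= Gamma l r N m h.
Proof.
move=> K0 Kh hN Nm hm; rewrite /Gamma ltnNge Nm /=.
(* At [m = N] the value is [min h (l N - h)], whose first entry calls for [K <= h]. For [m > N] the
   term [l m - h] alone is at least [K]. *)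
case: eqVneq => [_|_]; first by rewrite le_min Kh; lra.
have -> : (l m <= h) = false by apply/negbTE; rewrite -ltNge; lra.
by rewrite ler_wpDr ?expR_sum_Delta_ge0//; lra.
Qed.

Lemma Gamma_ge_left l r N m h K : (m < N)%N -> 0 < K -> h + K <= l m ->
  K <= Gamma l r N m h.
Proof.
move=> mN K0 hm; rewrite /Gamma mN.
have -> : (l m <= h) = false by apply/negbTE; rewrite -ltNge; lra.
by rewrite ler_wpDr ?expR_sum_Delta_ge0//; lra.
Qed.

Lemma min_Gamma_le_K_sup l r n h : (1 <= n)%N -> 0 <= h <= l n ->
  (min_Gamma l r n h <= K_sup l r)%E.
Proof.
move=> n1 hl.
apply: (@le_trans _ _
  (ereal_sup [set min_Gamma l r n h | h in [set h : R | 0 <= h <= l n]])).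
  by apply: ereal_sup_ubound; exists h.
by apply: ereal_sup_ubound; exists n.
Qed.

(** The height [h = 0] is admissible at [n], and every [Gamma] there is nonnegative. This rules out
    the value [-oo]. *)
Lemma K_sup_ge0 l r n : (1 <= n)%N -> 0 <= l n -> (0 <= K_sup l r)%E.
Proof.
move=> n1 ln0.
have h0 : (0 : R) <= 0 <= l n by rewrite lexx.
apply: le_trans (min_Gamma_le_K_sup l r n 0 n1 h0).
by apply/ereal_infP => _ [m _ <-]; rewrite lee_fin Gamma_ge0.
Qed.

Lemma sum_expRN_le l r c n N K : (1 <= n)%N -> (n <= N)%N ->
  (forall m, (n <= m)%N -> l n <= l m + c) ->
  0 < K -> (K_sup l r < K%:E)%E -> 2 * K + c <= l n ->
  \sum_(n <= k < N) expR (- l k) <= K * expR (K + c) * expR (- l n).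
Proof.
(* With this choice [h + K = l n - c] bounds every [l m] with [m >= n] from below, and [K <= h]
   amounts to [2 * K + c <= l n]. *)
move=> n1 nN lc K0 supK Kl; pose h := l n - c - K.
have hK m : (n <= m)%N -> h + K <= l m by move=> /lc; rewrite /h; lra.
have Kh : K <= h by rewrite /h; lra.
have hN : 0 <= h <= l N by have := hK N nN; lra.
have := le_lt_trans (min_Gamma_le_K_sup l r N h (leq_trans n1 nN) hN) supK.
(* The strict bound on the infimum yields an index with [Gamma < K], whether or not the infimum is
   attained. *)
move=> /ereal_inf_ltP[_ [m _ <-]]; rewrite lte_fin => GK.
have mn : (m < n)%N.
  rewrite ltnNge; apply/negP => nm; move: GK; apply/negP; rewrite -leNgt.
  case: (ltnP m N) => [mN|Nm]; first by apply: Gamma_ge_left => //; exact: hK.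
  by apply: Gamma_ge_right => //; exact: hK.
have := le_lt_trans (Gamma_ge_sum l r n m N h mn nN) GK.
move=> /ltW; rewrite mulrC -ler_pdivlMr ?expR_gt0 // => /le_trans; apply.
(* Here [- h = K + c - l n], which produces the constant. *)
rewrite -expRN -mulrA -expRD ler_pM2l // ler_expR /h; lra.
Qed.

(** The strict inequality [2 * K + c < l n] leaves room for all [x] in []K, (l n - c) / 2[]. The
    bound holds for each of them, and its right side is continuous in [x]. *)
Lemma sum_expRN_le_K_sup l r c n N K : (1 <= n)%N -> (n <= N)%N ->
  (forall m, (n <= m)%N -> l n <= l m + c) ->
  K_sup l r = K%:E -> 0 <= K -> 2 * K + c < l n ->
  \sum_(n <= k < N) expR (- l k) <= K * expR (K + c) * expR (- l n).
Proof.
move=> n1 nN lc supK K0 Kl.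
have cvgF : x * expR (x + c) * expR (- l n) @[x --> K^'+] -->
    K * expR (K + c) * expR (- l n).
  apply: cvg_at_right_filter.
  apply: cvgM; last exact: cvg_cst.
  apply: cvgM; first exact: cvg_id.
  apply: continuous_cvg; first exact: continuous_expR.
  by apply: cvgD; [exact: cvg_id|exact: cvg_cst].
apply: (cvgr_to_ge cvgF); near=> x.
have Kx : K < x by near: x; exact: nbhs_right_gt.
have xl : x < (l n - c) / 2 by near: x; apply: nbhs_right_lt; lra.
apply: (@sum_expRN_le l r) => //; rewrite ?supK ?lte_fin //; lra.
Unshelve. all: by end_near. Qed.

End Combinatorics.

Lemma geodesic_length_ge0 {R : realType} (Omega : set (Cplx R))
    (d : Cplx R -> Cplx R -> R) (a b : nat -> \bar R) (i j : nat) (L : R) :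
  geodesic_length_through Omega d a b i j L -> 0 <= L.
Proof.
by rewrite /geodesic_length_through; case: ifP => _; [move=> ->|case=> g [/ltW]].
Qed.

Theorem theorem3p17 (R : realType) (Omega : set (Cplx R)) (a b : nat -> \bar R)
    (lam : Cplx R -> R) (l r : nat -> R) (c1 : R)
    (Htrain : train Omega a b)
    (Hlam : poincare_density Omega lam)
    (Hhyp : gromov_hyperbolic Omega (induced_dist Omega lam))
    (Hlr : train_lengths Omega (induced_dist Omega lam) a b l r)
    (Hc1 : 0 < c1)
    (Hl : forall m n : nat, (1 <= m)%N -> (m <= n)%N -> l m <= l n + c1) :
  forall n : nat, (1 <= n)%N ->
    (2%:E * K_sup l r + c1%:E < (l n)%:E)%E ->
    (\sum_(n <= k <oo) (expR (- l k))%:E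
       <= K_sup l r * expeR (K_sup l r + c1%:E) * (expR (- l n))%:E)%E.
Proof.
move=> n n1 Kl.
have ln0 : 0 <= l n.
  by have [/geodesic_length_ge0 + _] := Hlr n n1; rewrite pmulr_rge0.
have := K_sup_ge0 l r n n1 ln0.
(* If the supremum were [+oo], the assumed inequality would read [+oo < l n]. *)
case supK : (K_sup l r) => [K| |] //; last by move: Kl; rewrite supK mulry gtr0_sg // mul1e.
rewrite lee_fin => K0; rewrite /= -!EFinM.
move: Kl; rewrite supK -EFinM -EFinD lte_fin => Kl.
(* The terms are nonnegative, so it suffices to bound every partial sum; those with [N < n] are
   empty. *)
apply: lime_le; first by apply: is_cvg_nneseries => k _ _; rewrite lee_fin expR_ge0.
apply: nearW => N; rewrite sumEFin lee_fin.
have [nN|/ltnW Nn] := leqP n N.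
  by apply: (sum_expRN_le_K_sup l r) => // m nm; exact: Hl.
by rewrite big_geq // !mulr_ge0 ?expR_ge0.
Qed.
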